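(* For every integer $n\ge 0$, let $a(n)$ denote the number of square-free words of length $n$ over the three-letter alphabet $\{0,1,2\}$. Then $a(n)\ge 2^{n/17}$ for every $n$, and hence the limit $\mu:=\lim_{n\to\infty} a(n)^{1/n}$ satisfies $\mu\ge 2^{1/17}$.
   Context: A word is a finite sequence of letters. A word is square-free if it cannot be written as a concatenation $a\,x\,x\,b$ with $a,b$ (possibly empty) words and $x$ a non-empty word. The empty word is the unique word of length $0$ and is square-free, so $a(0)=1$; the next values are $a(1)=3$, $a(2)=6$, $a(3)=12$, $a(4)=18$, $a(5)=30$, $a(6)=42$. The limit $\mu$ exists because $a(m+n)\le a(m)a(n)$ for all $m,n$ (Fekete's lemma). *)

(* Defs.v *)
From mathcomp Require Import all_boot all_order all_algebra.
From mathcomp Require Import all_classical all_reals all_analysis.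

Set Implicit Arguments.
Unset Strict Implicit.
Unset Printing Implicit Defensive.

Definition square_free (T : Type) (w : seq T) : Prop :=
  ~ exists a x b : seq T, x <> [::] /\ w = a ++ x ++ x ++ b.

Definition num_square_free (n : nat) : nat :=
  #|[set w : n.-tuple 'I_3 | `[< square_free (w : seq 'I_3) >]]%SET|.

(* Main.v *)
Require Import Defs.
From mathcomp Require Import all_boot all_order all_algebra.
From mathcomp Require Import all_classical all_reals all_analysis.
From mathcomp Require Import zify ring lra.

Set Implicit Arguments.
Unset Strict Implicit.
Unset Printing Implicit Defensive.

Import Order.TTheory GRing.Theory Num.Theory.
Import numFieldNormedType.Exports.

(** The letter [a] is replaced by one of two words of length 18, chosen freely
at each occurrence: the words of [brinkhuis] with [a] added modulo 3 (the
Brinkhuis triple pair of Ekhad and Zeilberger).  The image of a square-free word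
is square-free: a square of period less than 14 would show up inside the image of
three consecutive letters, and a longer period is a multiple of 18, because a
factor of length 14 of an image determines its position modulo 18; since the
first letter of a block determines the letter it replaces, such a square comes
from a square of letters.  Hence [2 ^ n * a n <= a (18 * n) <= a n ^ 18], so
[2 ^ n <= a n ^ 17]; the limit exists by Fekete's lemma applied to [ln (a n)]. *)

(** * Squares described by positions *)

(** The word is a total function cut at [n], so that squares are moved by arithmetic on the start
    [p] and the period [l]. *)
Definition has_square (T : Type) (f : nat -> T) (n : nat) : Prop :=
  exists p l, [/\ 0 < l, p + l + l <= n & forall i, i < l -> f (p + i) = f (p + l + i)].

(** Serves both to recode the letters and to exchange functions that agree below [n]. *)
Lemma eq_has_square (T U : Type) (f : nat -> T) (g : nat -> U) n :
  (forall i j, i < n -> j < n -> g i = g j -> f i = f j) ->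
  has_square g n -> has_square f n.
Proof.
move=> fg [p [l [l0 pln gE]]]; exists p, l; split=> // i il.
by apply: fg; [lia|lia|exact: gE].
Qed.

Lemma square_freeP (T : Type) (x0 : T) (w : seq T) :
  square_free w <-> ~ has_square (nth x0 w) (size w).
Proof.
split=> sqf; apply: contra_not sqf.
- case=> p [l [l0 plw wE]].
  exists (take p w), (take l (drop p w)), (drop l (drop l (drop p w))); split.
    by move/(congr1 size); rewrite /= size_takel ?size_drop; lia.
  have xE : take l (drop p w) = take l (drop l (drop p w)).
    apply: (@eq_from_nth _ x0); rewrite !size_takel ?size_drop; try lia.
    move=> i il; rewrite !nth_take // !nth_drop wE //; congr nth; lia.
  by rewrite {2}xE !cat_take_drop.
- case=> a [x [b [x0' ->]]]; exists (size a), (size x); split.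
  + by case: x x0'.
  + by rewrite !size_cat; lia.
  + move=> i ix.
    have nthD (y z : seq T) j : nth x0 (y ++ z) (size y + j) = nth x0 z j.
      by rewrite nth_cat ltnNge leq_addr addKn.
    by rewrite -addnA !nthD !nth_cat ix.
Qed.

Lemma square_free_mktuple (T : Type) n (g : nat -> T) :
  square_free [tuple g i | i < n] <-> ~ has_square g n.
Proof.
have nthE k : k < n -> nth (g 0) [tuple g i | i < n] k = g k.
  by move=> kn; rewrite -[k]/(nat_of_ord (Ordinal kn)) nth_mktuple.
rewrite (square_freeP (g 0)) size_tuple.
by split; apply: contra_not; apply: eq_has_square => i j ? ?; rewrite !nthE.
Qed.

(** * The substitution and its two finite checks *)

Definition brinkhuis (c : bool) : seq nat :=
  if c then [:: 0; 1; 2; 0; 2; 1; 0; 2; 0; 1; 0; 2; 1; 2; 0; 2; 1; 0]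
  else [:: 0; 1; 2; 0; 2; 1; 2; 0; 1; 0; 2; 0; 1; 2; 0; 2; 1; 0].

Definition block (x : bool * nat) : seq nat :=
  [seq (a + x.2) %% 3 | a <- brinkhuis x.1].

Definition image_letter (t : nat -> bool * nat) (k : nat) : nat :=
  nth 0 (block (t (k %/ 18))) (k %% 18).

Definition image_factor (t : nat -> bool * nat) (q k : nat) : seq nat :=
  flatten [seq block (t j) | j <- iota q k].

(** For the lengths 2 and 3 that are checked, distinct neighbouring letters already mean a
    square-free word of letters. *)
Fixpoint chains (k : nat) : seq (seq (bool * nat)) :=
  if k is k'.+1 then
    [seq s <- [seq x :: s | x <- [seq (c, a) | c <- [:: true; false], a <- iota 0 3],
                            s <- chains k']
       | sorted (fun x y => x.2 != y.2) s]
  else [:: [::]].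

Definition chain_images (k : nat) : seq (seq nat) :=
  [seq flatten (map block s) | s <- chains k].

(** Three blocks suffice: a square of period at most 13 that starts in the first block ends by
    position 17 + 13 + 13 = 43, below 54. *)
Lemma no_short_square_check :
  all (fun w => all (fun p => all (fun l =>
    take l (drop p w) != take l (drop (p + l) w)) (iota 1 13)) (iota 0 18))
    (chain_images 3).
Proof. by vm_compute. Qed.

(** Two blocks suffice: a factor of length 14 that starts in the first block ends by position 17 +
    14 = 31, below 36. *)
Lemma synchronization_check :
  all (fun u => all (fun v => all (fun r => all (fun s =>
    (take 14 (drop r u) == take 14 (drop s v)) ==> (r == s))
    (iota 0 18)) (iota 0 18)) (chain_images 2)) (chain_images 2).
Proof. by vm_compute. Qed.

(** * Reading factors of the image inside a few blocks *)

Lemma size_block x : size (block x) = 18.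
Proof. by rewrite size_map; case: x.1. Qed.

Lemma image_letter_lt3 t k : image_letter t k < 3.
Proof.
have k18 : k %% 18 < size (brinkhuis (t (k %/ 18)).1).
  by case: (t _).1 => /=; lia.
by rewrite /image_letter /block (nth_map 0) // ltn_pmod.
Qed.

Lemma size_image_factor t q k : size (image_factor t q k) = 18 * k.
Proof.
elim: k q => [|k IHk] q //; rewrite /image_factor /= size_cat size_block.
by rewrite -/(image_factor t q.+1 k) IHk; lia.
Qed.

Lemma nth_image_factor t q k i : i < 18 * k ->
  nth 0 (image_factor t q k) i = image_letter t (18 * q + i).
Proof.
elim: k q i => [|k IHk] q i ik; first lia.
rewrite /image_factor /= nth_cat size_block; case: ltnP => i18.
  rewrite /image_letter; congr (nth 0 (block (t _)) _); lia.
rewrite -/(image_factor t q.+1 k) IHk; last lia.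
congr image_letter; lia.
Qed.

(** The offset [d] is 0 or the period, so both halves of a square are read in the same factor. *)
Lemma take_drop_image_factor t p k d l : p %% 18 + d + l <= 18 * k ->
  take l (drop (p %% 18 + d) (image_factor t (p %/ 18) k)) =
  [seq image_letter t (p + d + i) | i <- iota 0 l].
Proof.
move=> pdl; apply: (@eq_from_nth _ 0).
  by rewrite size_takel ?size_map ?size_iota // size_drop size_image_factor; lia.
rewrite size_takel => [i il|]; last by rewrite size_drop size_image_factor; lia.
rewrite nth_take // nth_drop nth_image_factor; last lia.
rewrite (nth_map 0) ?size_iota // nth_iota //; congr image_letter; lia.
Qed.

Lemma image_factor_mem t q k :
  (forall k, (t k).2 < 3) -> (forall k, (t k).2 != (t k.+1).2) ->
  image_factor t q k \in chain_images k.
Proof.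
move=> t_lt3 t_step.
rewrite /image_factor [X in flatten X]map_comp; apply: map_f.
elim: k q => [|k IHk] q; first by rewrite inE.
rewrite mem_filter; apply/andP; split.
  elim: k q {IHk} => [|k IHk] q //=.
  by rewrite t_step /=; exact: (IHk q.+1).
apply: allpairs_f => //.
by case: (t q) (t_lt3 q) => -[] [|[|[|a]]].
Qed.

(** * Squares of the image come from squares of letters *)

Lemma image_no_short_square t p l :
  (forall k, (t k).2 < 3) -> (forall k, (t k).2 != (t k.+1).2) ->
  0 < l < 14 ->
  ~ (forall i, i < l -> image_letter t (p + i) = image_letter t (p + l + i)).
Proof.
move=> t_lt3 t_step l14 tE.
have p18 : p %% 18 \in iota 0 18 by rewrite mem_iota ltn_pmod.
have l13 : l \in iota 1 13 by rewrite mem_iota.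
have /allP w_ok := allP no_short_square_check _ (image_factor_mem (p %/ 18) 3 t_lt3 t_step).
have /allP p_ok := w_ok _ p18.
have /eqP := p_ok _ l13; apply.
have := @take_drop_image_factor t p 3 0 l.
rewrite !addn0 => ->; last lia.
rewrite take_drop_image_factor; last lia.
apply/eq_in_map => i; rewrite mem_iota => /andP[_ il]; exact: tE.
Qed.

Lemma image_synchronization t p p' :
  (forall k, (t k).2 < 3) -> (forall k, (t k).2 != (t k.+1).2) ->
  (forall i, i < 14 -> image_letter t (p + i) = image_letter t (p' + i)) ->
  p %% 18 = p' %% 18.
Proof.
move=> t_lt3 t_step tE.
have in18 k : k %% 18 \in iota 0 18 by rewrite mem_iota ltn_pmod.
have /allP u_ok := allP synchronization_check _ (image_factor_mem (p %/ 18) 2 t_lt3 t_step).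
have /allP v_ok := u_ok _ (image_factor_mem (p' %/ 18) 2 t_lt3 t_step).
have /allP r_ok := v_ok _ (in18 p).
have /implyP s_ok := r_ok _ (in18 p').
apply/eqP/s_ok/eqP.
have := @take_drop_image_factor t p 2 0 14.
have := @take_drop_image_factor t p' 2 0 14.
rewrite !addn0 => -> ; last lia.
move=> ->; last lia.
apply/eq_in_map => i; rewrite mem_iota => /andP[_ il]; exact: tE.
Qed.

(** Both words of [brinkhuis] start with 0. *)
Lemma image_letter_start t q : (t q).2 < 3 -> image_letter t (18 * q) = (t q).2.
Proof.
move=> tq3; rewrite /image_letter mulKn // modnMr /block.
by case: (t q) tq3 => -[] a /= a3; rewrite add0n modn_small.
Qed.

(* Two blocks for the same letter first differ at index 6. *)
Lemma image_letter_inj t t' q : (t q).2 < 3 -> (t' q).2 < 3 ->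
  image_letter t (18 * q) = image_letter t' (18 * q) ->
  image_letter t (18 * q + 6) = image_letter t' (18 * q + 6) -> t q = t' q.
Proof.
move=> tq3 tq3'; rewrite !image_letter_start // /image_letter.
have -> : (18 * q + 6) %/ 18 = q by lia.
have -> : (18 * q + 6) %% 18 = 6 by lia.
case: (t q) (t' q) tq3 tq3' => c a [c' b] /= a3 _ <-.
rewrite /block !(nth_map 0); try by case: (c); case: (c').
by case: c; case: c' => //=; lia.
Qed.

Lemma image_has_square_step t n :
  (forall k, (t k).2 < 3) -> (forall k, (t k).2 != (t k.+1).2) ->
  has_square (image_letter t) (18 * n) -> has_square (fun k => (t k).2) n.
Proof.
move=> t3 tS [p [l [l0 pln tE]]].
have l14 : 14 <= l.
  rewrite leqNgt; apply/negP => l14.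
  by apply: (image_no_short_square t3 tS) tE; rewrite l0.
(* The two halves share their first 14 letters, so 18 divides [l]. *)
have := image_synchronization t3 tS (p := p) (p' := p + l).
move=> /(_ (fun i i14 => tE i (leq_trans i14 l14))) pl.
(* Rounding up gives the first block that starts at or after [p]; the [l %/ 18] blocks from there on
   start in the first half, and first letters are compared. *)
exists ((p + 17) %/ 18), (l %/ 18); split; [lia | lia |] => j jl.
rewrite -[LHS](image_letter_start (t3 _)) -[RHS](image_letter_start (t3 _)).
have [i il pi] : exists2 i, i < l & 18 * ((p + 17) %/ 18 + j) = p + i.
  by exists (18 * ((p + 17) %/ 18 + j) - p); lia.
rewrite pi tE //; congr image_letter; lia.
Qed.

Lemma image_has_square t n : (forall k, k < n -> (t k).2 < 3) ->
  has_square (image_letter t) (18 * n) -> has_square (fun k => (t k).2) n.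
Proof.
move=> t3 tsq; apply: contrapT => tsqf.
have n0 : 0 < n by case: tsq => p [l [? ? _]]; lia.
(* The previous lemma needs its hypotheses at every position. From [n] on the letters continue the
   last one by adding 1 modulo 3, so neighbours differ there and across the seam. *)
pose t' k := if k < n then t k else (false, ((t n.-1).2 + (k - n.-1)) %% 3).
have t'E k : k < n -> t' k = t k by rewrite /t' => ->.
apply: (tsqf); apply: (@eq_has_square _ _ _ (fun k => (t' k).2)).
  by move=> i j ? ?; rewrite !t'E.
apply: image_has_square_step.
- by move=> k; rewrite /t'; case: ifP => [/t3//|_]; rewrite ltn_pmod.
- move=> k; rewrite /t'; have [kn|nk] := ltnP k.+1 n.
    (* Equal neighbours would be a square of period 1. *)
    rewrite ltnW //; apply/eqP => tk; apply: (tsqf); exists k, 1; split=> //; first lia.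
    by case=> // _; rewrite !addn0 addn1.
  have tn3 : (t n.-1).2 < 3 by apply: t3; lia.
  have [kn|kn] /= := ltnP k n; last lia.
  have -> : k = n.-1 by lia.
  lia.
- apply: eq_has_square tsq => i j ? ?; rewrite /image_letter !t'E //; lia.
Qed.

(** * Counting the images *)

Definition brinkhuis_image n (x : n.-tuple bool * n.-tuple 'I_3) :
    (18 * n).-tuple 'I_3 :=
  [tuple (inord (image_letter
            (fun k => (nth false x.1 k, nat_of_ord (nth ord0 x.2 k))) i) : 'I_3)
  | i < 18 * n].

Lemma brinkhuis_image_inj n : injective (@brinkhuis_image n).
Proof.
move=> [c s] [c' s'] eq_im.
have letterE k : k < 18 * n ->
    image_letter (fun k => (nth false c k, nat_of_ord (nth ord0 s k))) k =
    image_letter (fun k => (nth false c' k, nat_of_ord (nth ord0 s' k))) k.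
  move=> kn; have := congr1 (fun w => val (tnth w (Ordinal kn))) eq_im.
  by rewrite !tnth_mktuple /= !inordK ?image_letter_lt3.
have csE k : k < n -> (nth false c k, nat_of_ord (nth ord0 s k)) =
                     (nth false c' k, nat_of_ord (nth ord0 s' k)).
  move=> kn; apply: (@image_letter_inj
    (fun k => (nth false c k, nat_of_ord (nth ord0 s k)))
    (fun k => (nth false c' k, nat_of_ord (nth ord0 s' k)))) => //=;
  by apply: letterE; lia.
congr (_, _); apply/val_inj.
- by apply: (@eq_from_nth _ false); rewrite !size_tuple // => i /csE[].
- apply: (@eq_from_nth _ ord0); rewrite !size_tuple // => i /csE [_ ?].
  exact: val_inj.
Qed.

Lemma square_free_brinkhuis_image n (x : n.-tuple bool * n.-tuple 'I_3) :
  square_free (x.2 : seq 'I_3) -> square_free (brinkhuis_image x : seq 'I_3).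
Proof.
move/(square_freeP ord0); rewrite size_tuple => sqf.
apply/(square_free_mktuple (18 * n) (fun k => inord (image_letter _ k) : 'I_3)).
apply: contra_not sqf => sq.
apply: (@eq_has_square _ _ _ (fun k => nat_of_ord (nth ord0 x.2 k))).
  by move=> i j _ _ /val_inj.
apply: (@image_has_square
  (fun k => (nth false x.1 k, nat_of_ord (nth ord0 x.2 k)))) => //=.
apply: eq_has_square sq => i j _ _ /(congr1 val).
by rewrite /= !inordK ?image_letter_lt3.
Qed.

Lemma num_square_free_image n :
  2 ^ n * num_square_free n <= num_square_free (18 * n).
Proof.
rewrite /num_square_free.
set A := [set w : n.-tuple 'I_3 | _]%SET.
have -> : 2 ^ n * #|A| = #|brinkhuis_image (n := n) @: finset.setX [set: n.-tuple bool]%SET A|.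
  by rewrite card_imset ?cardsX ?cardsT ?card_tuple ?card_bool //; exact: brinkhuis_image_inj.
apply/subset_leq_card/fintype.subsetP => _ /imsetP[[c s] /finset.setXP[_ sA] ->].
move: sA; rewrite !finset.in_set => /asboolP sqf.
exact/asboolP/square_free_brinkhuis_image.
Qed.

(** * Submultiplicativity, positivity and the integer bound *)

Definition split_word m n (w : (m + n).-tuple 'I_3) :
    m.-tuple 'I_3 * n.-tuple 'I_3 :=
  ([tuple nth ord0 w i | i < m], [tuple nth ord0 w (m + i) | i < n]).

Lemma num_square_freeD m n :
  num_square_free (m + n) <= num_square_free m * num_square_free n.
Proof.
rewrite /num_square_free -cardsX.
set A := [set w : (m + n).-tuple 'I_3 | _]%SET.
have split_inj : injective (@split_word m n).
  move=> w w' eqw; apply/val_inj/(@eq_from_nth _ ord0); rewrite !size_tuple // => i imn.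
  have [im|mi] := ltnP i m.
    have := congr1 (fun x => tnth x.1 (Ordinal im)) eqw.
    by rewrite !tnth_mktuple.
  have inm : i - m < n by lia.
  have := congr1 (fun x => tnth x.2 (Ordinal inm)) eqw.
  by rewrite !tnth_mktuple /= subnKC.
rewrite -(card_imset A split_inj).
apply/subset_leq_card/fintype.subsetP => _ /imsetP[w wA ->].
move: wA; rewrite finset.in_set => /asboolP/(square_freeP ord0).
rewrite size_tuple => sqf; apply/finset.setXP; split; rewrite finset.in_set; apply/asboolP.
- apply/(square_free_mktuple m (nth ord0 w)); apply: contra_not sqf.
  by case=> p [l [l0 plm wE]]; exists p, l; split=> //; lia.
- apply/(square_free_mktuple n (fun i => nth ord0 w (m + i))).
  apply: contra_not sqf => -[p [l [l0 pln wE]]].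
  exists (m + p), l; split=> //; first lia.
  by move=> i /wE; rewrite !addnA.
Qed.

(** Iterating the substitution on one letter gives square-free words of length [18 ^ k];
    submultiplicativity carries positivity from [18 ^ n] down to [n]. *)
Lemma num_square_free_gt0 n : 0 < num_square_free n.
Proof.
have pow_gt0 k : 0 < num_square_free (18 ^ k).
  elim: k => [|k IHk].
    apply/card_gt0P; exists [tuple ord0]; rewrite finset.in_set.
    by apply/asboolP/(square_freeP ord0) => -[p [l [? /= ? _]]]; lia.
  rewrite expnS; apply: leq_trans (num_square_free_image _).
  by rewrite muln_gt0 expn_gt0.
have n18 : n <= 18 ^ n by exact/ltnW/ltn_expl.
have := leq_trans (pow_gt0 n) _.
move=> /(_ (num_square_free n * num_square_free (18 ^ n - n))).
by rewrite -{1}(subnKC n18) num_square_freeD muln_gt0 => /(_ isT)/andP[].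
Qed.

Lemma num_square_freeM k n : num_square_free (k.+1 * n) <= num_square_free n ^ k.+1.
Proof.
elim: k => [|k IHk]; first by rewrite mul1n expn1.
rewrite mulSn expnS; apply: leq_trans (num_square_freeD _ _) _.
by rewrite leq_mul2l IHk orbT.
Qed.

Lemma num_square_free_exp17 n : 2 ^ n <= num_square_free n ^ 17.
Proof.
have := leq_trans (num_square_free_image n) (num_square_freeM 17 n).
by rewrite expnSr leq_pmul2r // num_square_free_gt0.
Qed.

(** * Fekete's lemma, the limit and its lower bound *)

Local Open Scope classical_set_scope.
Local Open Scope ring_scope.

Lemma fekete (R : realType) (u : nat -> R) :
  (forall n, 0 <= u n) -> (forall m n, u (m + n)%N <= u m + u n) ->
  (u n / n%:R) @[n --> \oo] --> inf [set u n / n%:R | n in [set n | (0 < n)%N]].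
Proof.
move=> u0 uD; set E := [set _ | _ in _].
have E_ge0 : lbound E 0 by move=> _ [n _ <-]; rewrite divr_ge0.
have E_inf : has_inf E by split; [exists (u 1%N / 1); exists 1%N | exists 0].
have uM q m r : u (q * m + r)%N <= q%:R * u m + u r.
  elim: q => [|q IHq]; first by rewrite mul0n mul0r !add0n add0r.
  rewrite mulSn -addnA (le_trans (uD _ _))// -natr1; lra.
apply/cvgrPdist_le => e e0.
have [|_ [m /= m0 <-] um] := @inf_adherent R E (e / 2) _ E_inf; first lra.
(* With [m] such that [u m / m] is within [e / 2] of the infimum, divide [n] by [m]; [B] bounds [u]
   at every remainder, and [B / n] takes up the other [e / 2]. *)
pose B := m%:R * u 1%N + u 0%N.
have uB n : u n <= n%:R / m%:R * u m + B.
  rewrite {1}(divn_eq n m) (le_trans (uM _ _ _))// lerD//.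
    rewrite ler_wpM2r// ler_pdivlMr ?ltr0n// -natrM ler_nat; lia.
  (* The remainder is split into ones, which leaves the term [u 0]. *)
  have := uM (n %% m)%N 1%N 0%N; rewrite muln1 addn0 => /le_trans; apply.
  by rewrite /B lerD2r ler_wpM2r// ler_nat ltnW// ltn_pmod.
near=> n.
have n0 : (0 < n)%N by near: n; exact: nbhs_infty_ge.
have nR0 : 0 < n%:R :> R by rewrite ltr0n.
have Bn : B / (e / 2) <= n%:R by near: n; exact: nbhs_infty_ger.
have Ln : inf E <= u n / n%:R by apply: ge_inf; [case: E_inf|by exists n].
rewrite distrC ger0_norm ?subr_ge0// lerBlDl.
have : u n / n%:R <= u m / m%:R + B / n%:R.
  rewrite ler_pdivrMr// (le_trans (uB n))// mulrDl divfK ?gt_eqF//.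
  by rewrite lerD2r mulrAC -mulrA mulrC.
have : B / n%:R <= e / 2.
  by rewrite ler_pdivrMr// mulrC -ler_pdivrMr//; lra.
lra.
Unshelve. all: by end_near. Qed.

Lemma cvg_num_square_free_root (R : realType) :
  cvg ((num_square_free n)%:R `^ (n%:R)^-1 @[n --> \oo] : set_system R).
Proof.
pose u n : R := ln (num_square_free n)%:R.
have a0 n : 0 < (num_square_free n)%:R :> R by rewrite ltr0n num_square_free_gt0.
have u0 n : 0 <= u n by rewrite ln_ge0// ler1n num_square_free_gt0.
have uD m n : u (m + n)%N <= u m + u n.
  rewrite /u -lnM ?posrE// ler_ln ?posrE ?mulr_gt0//.
  by rewrite -natrM ler_nat num_square_freeD.
have := cvg_comp _ _ (fekete u0 uD) (@continuous_expR R _).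
set l := expR _ => ul; apply/cvg_ex; exists l; apply: cvg_trans ul.
apply: near_eq_cvg; near=> n.
by rewrite /= /powR gt_eqF// mulrC.
Unshelve. all: by end_near. Qed.

Lemma powR2_le_num_square_free (R : realType) (n : nat) :
  2 `^ (n%:R / 17) <= (num_square_free n)%:R :> R.
Proof.
rewrite -(@ler_pXn2r _ 17) ?nnegrE ?powR_ge0//.
rewrite -!powR_mulrn ?powR_ge0// -powRrM divfK// ?pnatr_eq0//.
by rewrite !powR_mulrn// -!natrX ler_nat num_square_free_exp17.
Qed.

Theorem mainTheorem1 (R : realType) :
  (forall n : nat, 2 `^ (n%:R / 17) <= (num_square_free n)%:R :> R) /\
  (exists mu : R,
     ((num_square_free n)%:R `^ (n%:R)^-1 : R) @[n --> \oo] --> mu /\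
     2 `^ (17^-1) <= mu).
Proof.
have lower := @powR2_le_num_square_free R; split=> //.
have /cvg_ex[mu mu_lim] := @cvg_num_square_free_root R.
exists mu; split=> //; apply: cvgr_to_ge mu_lim _; near=> n.
have n0 : n%:R != 0 :> R by rewrite pnatr_eq0 -lt0n; near: n; exact: nbhs_infty_ge.
rewrite (_ : 17^-1 = n%:R / 17 * n%:R^-1 :> R); last by field.
by rewrite powRrM ge0_ler_powR ?nnegrE ?invr_ge0 ?powR_ge0.
Unshelve. all: by end_near. Qed.
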